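(* Let $k\ge2$. The $\mathcal L$-order on the set of $\mathcal L$-classes of $M_{k,1}$ is embeddable into the idempotent order of $M_{k,1}$ as follows. For $j=0,1$, the function ${\sf func}_j({\sf part}(\cdot))$, defined on the set of $\mathcal L$-classes of $M_{k,1}$, is injective; and for any $\psi,\varphi\in{\sf riHom}(A^* )$ and $j=0,1$: $$\psi\le_{\mathcal L}\varphi\quad\text{iff}\quad{\sf func}_j({\sf part}(\psi))\le{\sf func}_j({\sf part}(\varphi)),$$ where $\le_{\mathcal L}$ and $\le$ are the $\mathcal L$-preorder and the idempotent order of $M_{k,1}$.
   Context: $A$ is a (totally ordered) alphabet with $k\ge2$ letters, $A^*$ the free monoid over $A$. A right ideal of $A^*$ is a set $R\subseteq A^*$ with $RA^*\subseteq R$. A prefix code is a set of words none of which is a prefix of another; every right ideal is $PA^*$ for a unique prefix code $P$. A right ideal homomorphism is a function $\varphi$ whose domain ${\sf Dom}(\varphi)\subseteq A^*$ is a right ideal, with values in $A^*$ and $\varphi(xw)=\varphi(x)w$ for all $x\in{\sf Dom}(\varphi)$, $w\in A^*$; ${\sf domC}(\varphi)$ is the prefix code generating ${\sf Dom}(\varphi)$. ${\sf riHom}(A^* )$ is the set of right ideal homomorphisms with finitely generated domain. A right ideal $R'\subseteq R$ is essential in the right ideal $R$ iff $R'$ intersects every nonempty right ideal contained in $R$. $\Phi$ is an essentially equal restriction of $\varphi$ (and $\varphi$ an essentially equal extension of $\Phi$) iff $\Phi$ is a restriction of $\varphi$ and ${\sf Dom}(\Phi)$ is essential in ${\sf Dom}(\varphi)$.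 Every $\varphi\in{\sf riHom}(A^* )$ has a unique maximal essentially equal extension $\max(\varphi)$. The Thompson-Higman monoid is $M_{k,1}=\{\max(\varphi):\varphi\in{\sf riHom}(A^* )\}$ with multiplication $\psi\varphi=\max(\psi\circ\varphi)$ (functions act on the left); $\varphi\in{\sf riHom}(A^* )$ represents the element $\max(\varphi)$, and relations of $M_{k,1}$ are applied to homomorphisms via the elements they represent. $\psi\le_{\mathcal L}\varphi$ means $\psi=\alpha\varphi$ in $M_{k,1}$ for some $\alpha\in M_{k,1}$; $\mathcal L$-classes are the classes of the associated equivalence. For idempotents $e,f$, $e\le f$ means $e=ef=fe$. A prefix code congruence $\simeq$ is an equivalence relation on a right ideal $PA^*={\sf Dom}(\simeq)$, $P$ a finite prefix code, whose classes are exactly the sets $P_iw$ ($w\in A^*$, $1\le i\le n$) for some partition $\{P_1,\dots,P_n\}$ of $P$. For $\varphi\in{\sf riHom}(A^* )$, ${\sf part}(\varphi)$ is the equivalence relation on ${\sf Dom}(\varphi)$ given by $x_1\equiv x_2$ iff $\varphi(x_1)=\varphi(x_2)$. It is a prefix code congruence iff $\varphi({\sf domC}(\varphi))$ is a prefix code; every element of $M_{k,1}$ has a representative with this property, and whenever ${\sf part}(\varphi)$ is used, $\varphi$ is assumed to have this property. For a prefix code congruence $\simeq$ with class of $x$ denoted $[x]$, ${\sf func}_0(\simeq)$ and ${\sf func}_1(\simeq)$ are the elements of ${\sf riHom}(A^* )$ with domain ${\sf Dom}(\simeq)$ given by $x\mapsto\min_{\sf dict}([x])$ and $x\mapsto\max_{\sf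 dict}([x])$ respectively, the minimum and maximum being for the dictionary order on $A^*$. They represent idempotents of $M_{k,1}$. The value of ${\sf func}_j({\sf part}(\cdot))$ on an $\mathcal L$-class is the element of $M_{k,1}$ represented by ${\sf func}_j({\sf part}(\varphi))$ for any such representative $\varphi$ of an element of the class. *)

(* Defs.v *)
From HB Require Import structures.
From mathcomp Require Import all_boot all_order.
From mathcomp Require Import all_classical.

Set Implicit Arguments.
Unset Strict Implicit.
Unset Printing Implicit Defensive.

Import Order.TTheory.
Local Open Scope classical_set_scope.

Section RightIdeals.
Context {A : choiceType}.
Implicit Types (R S P : set (seq A)) (x y w : seq A).

Definition right_ideal R := forall x w, R x -> R (x ++ w).

Definition prefix_code P := forall p q, P p -> P q -> prefix p q -> p = q.

Definition rmul P w : set (seq A) := [set p ++ w | p in P].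

(* [gen P] is P A^* *)
Definition gen P : set (seq A) := [set p ++ w | p in P & w in setT].

Definition essential R S :=
  R `<=` S /\
  forall I, right_ideal I -> I !=set0 -> I `<=` S -> R `&` I !=set0.

Lemma gen_right_ideal P : right_ideal (gen P).
Proof.
by move=> _ w [p Pp [v _ <-]]; exists p => //; exists (v ++ w); rewrite ?catA.
Qed.

Lemma prefix_comparable (p q u v : seq A) :
  p ++ u = q ++ v -> prefix p q || prefix q p.
Proof.
by elim: p q => [|a p IH] [|b q] //= [-> /IH]; rewrite eqxx.
Qed.

Lemma cat_inj_r (x y w : seq A) : x ++ w = y ++ w -> x = y.
Proof.
move=> e; have/eqP := congr1 size e.
by rewrite !size_cat eqn_add2r => /eqP sxy; move/eqP: e;
  rewrite eqseq_cat // => /andP[/eqP].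
Qed.

Lemma prefix_code_cat P (p q u v : seq A) : prefix_code P ->
  P p -> P q -> p ++ u = q ++ v -> p = q /\ u = v.
Proof.
move=> Pc Pp Pq e.
have pq : p = q.
  by case/orP: (prefix_comparable e) => /Pc -> //.
split=> //; move: e; rewrite pq => /eqP.
by rewrite eqseq_cat // eqxx => /eqP.
Qed.

End RightIdeals.

Section Homomorphisms.
Context {A : choiceType}.
Implicit Types (f g : seq A -> option (seq A)) (x y w : seq A).

(* A partial function on words is a map into an option type. *)
Definition Dom f : set (seq A) := [set x | f x].

Definition ri_hom f := forall x y w, f x = Some y -> f (x ++ w) = Some (y ++ w).

Lemma DomP f x : Dom f x <-> exists y, f x = Some y.
Proof.
rewrite /Dom /=; case: (f x) => [y|]; split=> //; last by case.
by exists y.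
Qed.

Lemma Dom_right_ideal f : ri_hom f -> right_ideal (Dom f).
Proof. by move=> hf x w /DomP[y /hf e]; apply/DomP; exists (y ++ w). Qed.

End Homomorphisms.

Record riHom (A : choiceType) := RiHom {
  ri_fun :> seq A -> option (seq A);
  ri_homP : ri_hom ri_fun;
  ri_fg : exists2 P : set (seq A), finite_set P & Dom ri_fun = gen P }.

HB.instance Definition _ (A : choiceType) := gen_eqMixin (riHom A).
HB.instance Definition _ (A : choiceType) := gen_choiceMixin (riHom A).

Section ThompsonHigman.
Context {A : choiceType}.
Implicit Types (f g h : riHom A) (x y w : seq A).

Lemma riHom_ext f g : f =1 g -> f = g.
Proof.
case: f g => [f f1 f2] [g g1 g2] /= /funext fg; subst g.
by congr RiHom; exact: Prop_irrelevance.
Qed.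

Definition restriction f g := forall x y, f x = Some y -> g x = Some y.

Definition ess_equal_ext f g := restriction f g /\ essential (Dom f) (Dom g).

Definition is_max_ext f g :=
  ess_equal_ext f g /\
  forall h, ess_equal_ext f h -> restriction g h -> h = g.

(* By [is_max_ext_max] and [is_max_ext_unique] below, the default value of
   [xget] is never used and [max f] is the unique maximal extension. *)
Definition max f : riHom A := xget f [set g | is_max_ext f g].

Lemma ess_equal_ext_refl f : ess_equal_ext f f.
Proof.
split=> //; split=> // I _ [x Ix] /(_ _ Ix) fx; by exists x.
Qed.

Lemma ess_meet f g x : ess_equal_ext f g -> Dom g x ->
  exists w, Dom f (x ++ w).
Proof.
move=> [_ [_ ess]] gx.
have [] := ess [set x ++ w | w in setT].
- by move=> _ w [v _ <-]; exists (v ++ w); rewrite ?catA.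
- by exists (x ++ [::]), [::].
- by move=> _ [w _ <-]; apply: Dom_right_ideal => //; exact: ri_homP.
by move=> z [fz [w _ e]]; exists w; rewrite e.
Qed.

Lemma ess_agree f g h x y z : ess_equal_ext f g -> ess_equal_ext f h ->
  g x = Some y -> h x = Some z -> y = z.
Proof.
move=> fg fh gx hx.
have [|w /DomP[u fu]] := @ess_meet _ _ x fg; first by apply/DomP; exists y.
have := fg.1 _ _ fu; rewrite (ri_homP w gx) => -[e1].
have := fh.1 _ _ fu; rewrite (ri_homP w hx) => -[e2].
by apply: (@cat_inj_r _ _ _ w); rewrite e1 e2.
Qed.

Definition union_ext f x : option (seq A) :=
  xget None [set o | exists g y, [/\ ess_equal_ext f g, g x = Some y & o = Some y]].

Lemma union_extP f x y :
  union_ext f x = Some y <-> exists2 g, ess_equal_ext f g & g x = Some y.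
Proof.
split.
  rewrite /union_ext; case: xgetP => // o _ [g [z [fg gx ->]]] [<-]; by exists g.
move=> [g fg gx]; apply: xget_unique; first by exists g, y.
by move=> _ [h [z [fh hx ->]]]; rewrite (ess_agree fg fh gx hx).
Qed.

Lemma union_ext_hom f : ri_hom (union_ext f).
Proof.
move=> x y w /union_extP[g fg gx]; apply/union_extP; exists g => //.
exact: ri_homP.
Qed.

Lemma union_ext_fg f :
  exists2 P : set (seq A), finite_set P & Dom (union_ext f) = gen P.
Proof.
have [P finP fP] := ri_fg f.
have /finite_seqP[s sP] := finP.
exists (Dom (union_ext f) `&`
        [set` flatten [seq [seq take i p | i <- iota 0 (size p).+1] | p <- s]]).
  by apply: finite_setIr; exact: finite_seq.
apply/seteqP; split=> [x Ux|_ [p [Up _] [w _ <-]]]; last first.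
  exact: Dom_right_ideal (@union_ext_hom f) _ _ Up.
have /DomP[y /union_extP[g fg gx]] := Ux.
have [|w] := @ess_meet _ _ x fg; first by apply/DomP; exists y.
rewrite fP => -[p Pp [u _ e]].
have sp : p \in s by move: Pp; rewrite sP.
have Up : Dom (union_ext f) p.
  have : Dom f p by rewrite fP; exists p => //; exists [::] => //; rewrite cats0.
  move=> /DomP[z fz]; apply/DomP; exists z; apply/union_extP; exists f => //.
  exact: ess_equal_ext_refl.
case/orP: (prefix_comparable e) => /prefixP[v xv].
- exists p; last by exists v.
  split=> //; apply/flatten_mapP; exists p => //.
  by apply/mapP; exists (size p); rewrite ?take_size // mem_iota leqnn.
- exists x; last by exists [::] => //; rewrite cats0.
  split=> //; apply/flatten_mapP; exists p => //.
  apply/mapP; exists (size x); last by rewrite xv take_size_cat.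
  by rewrite mem_iota /= add0n ltnS xv size_cat leq_addr.
Qed.

Lemma union_ext_ess f :
  ess_equal_ext f (RiHom (@union_ext_hom f) (union_ext_fg f)).
Proof.
split=> [x y fx|].
  by apply/union_extP; exists f => //; exact: ess_equal_ext_refl.
split=> [x /DomP[y fx]|I rI [x Ix] /(_ _ Ix)].
  by apply/DomP; exists y; apply/union_extP; exists f => //;
    exact: ess_equal_ext_refl.
move=> /DomP[y /= /union_extP[g fg gx]].
have [|w fw] := @ess_meet _ _ x fg; first by apply/DomP; exists y.
by exists (x ++ w); split=> //; exact: rI.
Qed.

Lemma is_max_ext_ub f g h : is_max_ext f g -> ess_equal_ext f h -> restriction h g.
Proof.
move=> [fg gmax] fh.
rewrite -(gmax _ (union_ext_ess f)).
  by move=> x y hx; apply/union_extP; exists h.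
by move=> x y gx; apply/union_extP; exists g.
Qed.

Lemma is_max_ext_unique f g h : is_max_ext f g -> is_max_ext f h -> g = h.
Proof.
move=> fg [fh hmax]; apply: hmax; first exact: fg.1.
exact: is_max_ext_ub fg fh.
Qed.

Lemma is_max_ext_max f : is_max_ext f (max f).
Proof.
apply: (xgetI f (x := RiHom (@union_ext_hom f) (union_ext_fg f))).
split; first exact: union_ext_ess.
move=> h fh /= uh; apply: riHom_ext => x /=.
case e: (h x) => [y|]; first by apply/esym/union_extP; exists h.
by case e': (union_ext f x) => [y|] //; rewrite (uh _ _ e') in e.
Qed.

Lemma comp_hom g f : ri_hom (fun x => obind g (f x)).
Proof.
move=> x y w; case e: (f x) => [z|] //= gz.
by rewrite (ri_homP w e) /= (ri_homP w gz).
Qed.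

Lemma comp_fg g f :
  exists2 P : set (seq A), finite_set P & Dom (fun x => obind g (f x)) = gen P.
Proof.
have [P finP fP] := ri_fg f; have [Q finQ gQ] := ri_fg g.
pose D := Dom (fun x => obind g (f x)).
pose c (p q : seq A) := p ++ drop (size (odflt [::] (f p))) q.
exists (D `&` (P `|` [set c p q | p in P & q in Q])).
  by apply: finite_setIr; rewrite finite_setU; split=> //; exact: finite_image2.
apply/seteqP; split=> [x Dx|_ [p [Dp _] [w _ <-]]]; last first.
  exact: Dom_right_ideal (@comp_hom g f) _ _ Dp.
have /DomP[z] := Dx; case fx : (f x) => [y|] //= gy.
have : Dom f x by apply/DomP; exists y.
rewrite fP => -[p Pp [w _ xE]].
have : Dom f p by rewrite fP; exists p => //; exists [::] => //; rewrite cats0.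
move=> /DomP[r fp].
have yE : y = r ++ w by move: fx; rewrite -xE (ri_homP w fp) => -[].
have : Dom g y by apply/DomP; exists z.
rewrite gQ => -[q Qq [u _ e]].
have : Dom g q by rewrite gQ; exists q => //; exists [::] => //; rewrite cats0.
move=> /DomP[t gq].
have e' : q ++ u = r ++ w by rewrite e yE.
case/orP: (prefix_comparable e') => /prefixP[v vE].
- exists p; last by exists w.
  split; last by left.
  by apply/DomP; exists (t ++ v); rewrite fp /= vE (ri_homP v gq).
- exists (p ++ v).
    split.
      by apply/DomP; exists t; rewrite (ri_homP v fp) /= -vE.
    by right; exists p => //; exists q => //; rewrite /c fp /= vE drop_size_cat.
  exists u => //; rewrite -xE -catA; congr cat.
  by move/eqP: e'; rewrite vE -catA eqseq_cat // eqxx => /eqP.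
Qed.

Definition comp g f : riHom A := RiHom (@comp_hom g f) (comp_fg g f).

Lemma id_fg :
  exists2 P : set (seq A), finite_set P & Dom (@Some (seq A)) = gen P.
Proof.
exists [set [::]]; first exact: finite_set1.
by apply/seteqP; split=> // x _; exists [::] => //; exists x.
Qed.

Lemma id_ri_hom : ri_hom (@Some (seq A)).
Proof. by move=> x y w [->]. Qed.

Definition id_hom : riHom A := RiHom id_ri_hom id_fg.

End ThompsonHigman.

(* The Thompson-Higman monoid M_{k,1}, where k is the number of letters of A. *)
Definition THmonoid (A : choiceType) := {m : riHom A | range max m}.

HB.instance Definition _ (A : choiceType) := gen_eqMixin (THmonoid A).
HB.instance Definition _ (A : choiceType) := gen_choiceMixin (THmonoid A).

Section LOrder.
Context {A : choiceType}.
Implicit Types (a b e : THmonoid A).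

(* [elt f] is the element of the monoid that [f] represents. *)
Definition elt (f : riHom A) : THmonoid A := exist _ (max f) (imageT max f).

Definition mul b a : THmonoid A := elt (comp (sval b) (sval a)).

Definition leL b a := exists c, b = mul c a.

Definition Lclass a : set (THmonoid A) := [set b | leL b a /\ leL a b].

Definition idempotent_elt e := mul e e = e.

Definition le_idem e f :=
  [/\ idempotent_elt e, idempotent_elt f, e = mul e f & e = mul f e].

End LOrder.

Section Congruences.
Context {A : choiceType}.
Implicit Types (R : seq A -> seq A -> Prop) (D : set (seq A)).

Definition equivalence_on D R :=
  [/\ forall x y, R x y -> D x /\ D y,
      forall x, D x -> R x x,
      forall x y, R x y -> R y x &
      forall x y z, R x y -> R y z -> R x z].

(* [R x], read as a set of words, is the class of [x]. *)
Definition prefix_code_congruence R :=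
  exists (P : set (seq A)) (n : nat) (Pi : 'I_n -> set (seq A)),
    [/\ finite_set P,
        prefix_code P,
        equivalence_on (gen P) R,
        partition setT Pi P &
        [set R x | x in gen P] = [set rmul (Pi i) w | i in setT & w in setT]].

Definition part (f : riHom A) (x1 x2 : seq A) :=
  Dom f x1 /\ Dom f x2 /\ f x1 = f x2.

Lemma pcc_class_cat R x v : prefix_code_congruence R -> R x x ->
  R (x ++ v) (x ++ v) /\ R (x ++ v) = rmul (R x) v.
Proof.
move=> [P [n [Pi [_ Pc [RD Rrefl _ _] [PiP Pitriv _] cl]]]] Rx.
have PiS i p : Pi i p -> P p by rewrite -PiP; exists i.
have Dx := (RD _ _ Rx).1.
have Dxv : gen P (x ++ v) := gen_right_ideal v Dx.
have Rxv := Rrefl _ Dxv; split=> //.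
have [i _ [w _ Cx]] : [set rmul (Pi i) w | i in setT & w in setT] (R x).
  by rewrite -cl; exists x.
have [j _ [u _ Cxv]] : [set rmul (Pi i) w | i in setT & w in setT] (R (x ++ v)).
  by rewrite -cl; exists (x ++ v).
move: Rx; rewrite -{1}Cx => -[p Pp px].
move: Rxv; rewrite -{1}Cxv => -[q Pq qx].
have e : q ++ u = p ++ (w ++ v) by rewrite catA px.
have [pq uE] := prefix_code_cat Pc (PiS _ _ Pq) (PiS _ _ Pp) e.
have ji : j = i by apply: Pitriv => //; exists p; split=> //; rewrite -pq.
rewrite -Cxv -Cx ji uE; apply/seteqP; split=> [_ [r Pr <-]|_ [_ [r Pr <-] <-]].
  by exists (r ++ w); rewrite ?catA //; exists r.
by exists r; rewrite ?catA.
Qed.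

End Congruences.

Section Func.
Context {disp : Order.disp_t} {A : finOrderType disp}.
Implicit Types (R : seq A -> seq A -> Prop) (j : bool) (x y : seq A).

(* dictionary order *)
Definition dict_le x y := ((x : seqlexi A) <= (y : seqlexi A))%O.

Definition is_dict_min (C : set (seq A)) y := C y /\ forall z, C z -> dict_le y z.
Definition is_dict_max (C : set (seq A)) y := C y /\ forall z, C z -> dict_le z y.

Definition is_extremum j := if j then is_dict_max else is_dict_min.

(* [j = false] is func_0 and [j = true] is func_1.  The classes of a prefix code
   congruence are finite and nonempty, so the default of [xget] is irrelevant
   (see [extremum_exists]). *)
Definition func_fun j R x : option (seq A) :=
  if `[< R x x >] then Some (xget x [set y | is_extremum j (R x) y]) else None.

Lemma dict_le_anti x y : dict_le x y -> dict_le y x -> x = y.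
Proof.
move=> xy yx; apply: (@le_anti _ (seqlexi A)); apply/andP; split; [exact: xy|exact: yx].
Qed.

Lemma dict_le_refl x : dict_le x x.
Proof. exact: (@lexx _ (seqlexi A)). Qed.

Lemma dict_le_cat2 x y u : x = y \/ ~~ prefix x y && ~~ prefix y x ->
  dict_le (x ++ u) (y ++ u) = dict_le x y.
Proof.
case=> [->|]; first by rewrite !dict_le_refl.
rewrite /dict_le; elim: x y => [|a x IH] [|b y] //=.
by rewrite !lexi_cons; case: ltgtP => //= _; exact: IH.
Qed.

Lemma pcc_class_antichain R x y z : prefix_code_congruence R ->
  R x y -> R x z -> y = z \/ ~~ prefix y z && ~~ prefix z y.
Proof.
move=> [P [n [Pi [_ Pc [RD _ _ _] [PiP _ _] cl]]]] Rxy Rxz.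
have PiS i p : Pi i p -> P p by rewrite -PiP; exists i.
have [i _ [w _ Cx]] : [set rmul (Pi i) w | i in setT & w in setT] (R x).
  by rewrite -cl; exists x => //; exact: (RD _ _ Rxy).1.
move: Rxy Rxz; rewrite -Cx => -[p /PiS Pp <-] [q /PiS Pq <-].
have [->|pq] := eqVneq p q; [by left|right].
apply/andP; split; apply/negP => /prefixP[v]; rewrite -catA => e.
  by have [qp _] := prefix_code_cat Pc Pq Pp e; rewrite qp eqxx in pq.
by have [qp _] := prefix_code_cat Pc Pp Pq e; rewrite qp eqxx in pq.
Qed.

Lemma extremum_cat j R x v y : prefix_code_congruence R -> R x x ->
  is_extremum j (R (x ++ v)) (y ++ v) <-> is_extremum j (R x) y.
Proof.
move=> hR Rx; have [_ cl] := pcc_class_cat v hR Rx.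
have mem z : R (x ++ v) (z ++ v) <-> R x z.
  rewrite cl; split=> [[z' Rz' /cat_inj_r <-] //|Rz]; by exists z.
have le z t : R x z -> R x t -> dict_le (z ++ v) (t ++ v) = dict_le z t.
  by move=> Rz Rt; apply: dict_le_cat2; exact: pcc_class_antichain Rz Rt.
case: j; split=> -[/= Ry ext]; (split; first exact/mem);
  have {}Ry : R x y by [exact: Ry | exact/mem].
- by move=> z Rz; rewrite -le //; apply: ext; exact/mem.
- by rewrite cl => _ [t Rt <-]; rewrite le //; exact: ext.
- by move=> z Rz; rewrite -le //; apply: ext; exact/mem.
- by rewrite cl => _ [t Rt <-]; rewrite le //; exact: ext.
Qed.

Lemma extremum_unique j (C : set (seq A)) y z :
  is_extremum j C y -> is_extremum j C z -> y = z.
Proof.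
by case: j => -[Cy hy] [Cz hz]; apply: dict_le_anti; do ?[exact: hy|exact: hz].
Qed.

Lemma extremum_exists j R x : prefix_code_congruence R -> R x x ->
  exists y, is_extremum j (R x) y.
Proof.
move=> [P [n [Pi [Pf _ [RD _ _ _] [PiP _ _] cl]]]] Rx.
have [i _ [w _ Cx]] : [set rmul (Pi i) w | i in setT & w in setT] (R x).
  by rewrite -cl; exists x => //; exact: (RD _ _ Rx).1.
have /finite_seqP[s Cs] : finite_set (R x).
  rewrite -Cx; apply: finite_image; apply: sub_finite_set Pf.
  by rewrite -PiP => p ?; exists i.
move: Rx; rewrite Cs => /=; move: x {Cx Cs} => x; elim: s x => [//|a s IH] x _.
have [->|[b bs]] : s = [::] \/ exists b, b \in s.
- by case: (s) => [|b t]; [left|right; exists b; rewrite mem_head].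
- exists a; case: j {IH}; split; rewrite /= ?mem_head // => z;
  by rewrite mem_seq1 => /eqP ->; exact: dict_le_refl.
have [y] := IH b bs.
have tot := @le_total _ (seqlexi A) a y.
have tr := @le_trans _ (seqlexi A).
case: j {IH} => -[/= ys yext]; case/orP: tot => ay.
- exists y; split=> /=; first by rewrite inE ys orbT.
  by move=> z; rewrite inE => /orP[/eqP ->|/yext].
- exists a; split=> /=; first by rewrite mem_head.
  move=> z; rewrite inE => /orP[/eqP ->|/yext zy]; first exact: dict_le_refl.
  exact: tr zy ay.
- exists a; split=> /=; first by rewrite mem_head.
  move=> z; rewrite inE => /orP[/eqP ->|/yext yz]; first exact: dict_le_refl.
  exact: tr ay yz.
- exists y; split=> /=; first by rewrite inE ys orbT.
  by move=> z; rewrite inE => /orP[/eqP ->|/yext].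
Qed.

Lemma func_hom j R : prefix_code_congruence R -> ri_hom (func_fun j R).
Proof.
move=> hR x y w; rewrite /func_fun; case: asboolP => // Rx -[<-].
have [Rxw _] := pcc_class_cat w hR Rx.
rewrite asboolT //; congr Some.
have [y0 hy0] := extremum_exists j hR Rx.
rewrite (xget_unique _ hy0); last by move=> z hz; exact: extremum_unique hz hy0.
apply: xget_unique; first exact/extremum_cat.
by move=> z hz; apply: extremum_unique hz _; exact/extremum_cat.
Qed.

Lemma func_fg j R : prefix_code_congruence R ->
  exists2 P : set (seq A), finite_set P & Dom (func_fun j R) = gen P.
Proof.
move=> [P [n [Pi [Pf _ [RD Rrefl _ _] _ _]]]]; exists P => //.
apply/seteqP; split=> x; rewrite /Dom /func_fun /=.
  by case: asboolP => // /RD[].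
by move=> /Rrefl Rx; rewrite asboolT.
Qed.

Definition func j R (hR : prefix_code_congruence R) : riHom A :=
  RiHom (func_hom (j := j) hR) (func_fg j hR).

(* The map func_j(part(.)) on L-classes, defined by choosing a representative
   whose [part] is a prefix code congruence. *)
Definition func_part j (C : set (THmonoid A)) : THmonoid A :=
  xget (elt id_hom)
    [set m | exists f (hf : prefix_code_congruence (part f)),
       C (elt f) /\ m = elt (func j hf)].

End Func.

Arguments func {disp A} j {R} hR.

(* Main.v *)
Require Import Defs.
From mathcomp Require Import all_boot all_order.
From mathcomp Require Import all_classical.

(** Write [e_f] for [func j (part f)].  Pointwise [f = f e_f] and [e_f] factors
    through [f] on the left, so [f] and [e_f] are L-equivalent and
    [g <=_L f] iff [e_g = e_g e_f].  The latter equation already forces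
    [e_g = e_f e_g]: if [m] is the extremum of its [g]-class then, on an
    essential right ideal, [e_f m] lies in that same [g]-class, so [m] and
    [e_f m] bound each other in the dictionary order.  Every element has a
    representative whose [part] is a prefix code congruence: restrict [f] to
    the words whose image has length at least the maximal length of the images
    of the generators of its domain. *)

Set Implicit Arguments.
Unset Strict Implicit.
Unset Printing Implicit Defensive.

Local Open Scope classical_set_scope.

(** * Equality and products in the monoid, read off representatives *)

Section EssentialInclusion.
Context {A : choiceType}.
Implicit Types (f g h : riHom A) (x y w : seq A) (a b c : THmonoid A).

Lemma comp_Some g f x z :
  Defs.comp g f x = Some z <-> exists2 y, f x = Some y & g y = Some z.
Proof.
rewrite /=; case: (f x) => [y|] /=; last by split=> // -[].
by split=> [gy|[_ [<-]]]; first by exists y.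
Qed.

(* Two homomorphisms represent the same element of the monoid iff [ess_sub]
   holds in both directions ([eltP]). *)
Definition ess_sub f g :=
  forall x y, f x = Some y -> exists w, g (x ++ w) = Some (y ++ w).

Lemma ess_sub_trans g f h : ess_sub f g -> ess_sub g h -> ess_sub f h.
Proof.
move=> fg gh x y /fg[w /gh[v hv]]; exists (w ++ v).
by rewrite !catA.
Qed.

(** Two successive extensions of [x] suffice, one to enter the domain of [f'] and one for [g']. With
    [eltP], this lets [mul_elt] compute products on arbitrary representatives. *)
Lemma ess_sub_comp f f' g g' : ess_sub f f' -> ess_sub g g' ->
  ess_sub (Defs.comp g f) (Defs.comp g' f').
Proof.
move=> ff' gg' x z /=; case fx: (f x) => [y|] //= gy.
have [w fw] := ff' _ _ fx.
have [v gv] := gg' _ _ (ri_homP w gy).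
by exists (w ++ v); rewrite !catA (ri_homP v fw).
Qed.

Lemma ess_equal_ext_sub f g : ess_equal_ext f g -> ess_sub f g /\ ess_sub g f.
Proof.
move=> fg; split=> x y.
  by move=> /fg.1 gx; exists [::]; rewrite !cats0.
move=> gx; have [|w /DomP[u fw]] := ess_meet (x := x) fg.
  by apply/DomP; exists y.
by exists w; rewrite fw; have := fg.1 _ _ fw; rewrite (ri_homP w gx).
Qed.

Lemma ess_sub_max f : ess_sub f (Defs.max f) /\ ess_sub (Defs.max f) f.
Proof. exact: ess_equal_ext_sub (is_max_ext_max f).1. Qed.

Lemma sub_ess_equal_ext f g : restriction f g -> ess_sub g f -> ess_equal_ext f g.
Proof.
move=> fg gf; split=> //; split=> [x /DomP[y /fg gx]|I rI [x Ix] /(_ _ Ix)].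
  by apply/DomP; exists y.
move=> /DomP[y /gf[w fw]]; exists (x ++ w); split; last exact: rI.
by apply/DomP; exists (y ++ w).
Qed.

Lemma restriction_trans f g h :
  restriction f g -> restriction g h -> restriction f h.
Proof. by move=> fg gh x y /fg /gh. Qed.

Lemma ess_equal_ext_max f g : ess_equal_ext f g -> Defs.max f = Defs.max g.
Proof.
move=> fg; apply: is_max_ext_unique (is_max_ext_max f) _.
have [gm gmax] := is_max_ext_max g.
have [fg1 fg2] := ess_equal_ext_sub fg.
have [gm1 gm2] := ess_equal_ext_sub gm.
split.
  apply: sub_ess_equal_ext; first exact: restriction_trans fg.1 gm.1.
  exact: ess_sub_trans gm2 fg2.
(* Words of [Dom h] can be prolonged into [Dom f], hence into [Dom g], so the maximality of [max g]
   applies to [h]. *)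
move=> h fh mh; apply: gmax => //.
apply: sub_ess_equal_ext; first exact: restriction_trans gm.1 mh.
by apply: ess_sub_trans (ess_equal_ext_sub fh).2 _.
Qed.

(** Composing with a partial identity restricts a homomorphism, on the source or on the image side,
    and [comp] then supplies the finitely generated domain. *)
Definition id_on_fun (D : set (seq A)) x := if `[< D x >] then Some x else None.

Lemma id_on_hom D : right_ideal D -> ri_hom (id_on_fun D).
Proof.
move=> rD x y w; rewrite /id_on_fun; case: asboolP => // Dx [<-].
by rewrite asboolT //; exact: rD.
Qed.

Lemma Dom_id_on D : Dom (id_on_fun D) = D.
Proof. by apply/seteqP; split=> x; rewrite /Dom /id_on_fun /=; case: asboolP. Qed.

Lemma id_on_fg (P : set (seq A)) : finite_set P ->
  exists2 Q : set (seq A), finite_set Q & Dom (id_on_fun (gen P)) = gen Q.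
Proof. by exists P => //; exact: Dom_id_on. Qed.

Definition id_on P (finP : finite_set P) : riHom A :=
  RiHom (id_on_hom (@gen_right_ideal _ P)) (id_on_fg finP).

Lemma TH_val_inj a b : sval a = sval b -> a = b.
Proof.
by case: a b => [m hm] [m' hm'] /= e; subst m'; congr exist; exact: Prop_irrelevance.
Qed.

(** Mutual essential inclusion makes [f] and [g] agree wherever both are defined, by right
    cancellation. Their common restriction [h] is then essential in both, so all three have the same
    maximal extension. *)
Lemma eltP f g : elt f = elt g <-> ess_sub f g /\ ess_sub g f.
Proof.
have [f1 f2] := ess_sub_max f; have [g1 g2] := ess_sub_max g.
split=> [[fg]|[fg gf]].
  by split; [apply: ess_sub_trans f1 _; rewrite fg|
             apply: ess_sub_trans g1 _; rewrite -fg].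
have [P finP gP] := ri_fg g.
pose h := Defs.comp f (id_on finP).
have hE x : h x = if `[< gen P x >] then f x else None.
  by rewrite /h /= /id_on_fun; case: asboolP.
have hf : restriction h f by move=> x y; rewrite hE; case: asboolP.
have hg : restriction h g.
  move=> x y; rewrite hE; case: asboolP => //.
  rewrite -gP => /DomP[z gx] fx; rewrite gx; congr Some.
  have [w] := fg _ _ fx.
  by rewrite (ri_homP w gx) => -[/cat_inj_r].
have fh : ess_sub f h.
  move=> x y fx; have [w gw] := fg _ _ fx; exists w.
  rewrite hE asboolT ?(ri_homP w fx) // -gP.
  by apply/DomP; exists (y ++ w).
have gh : ess_sub g h by exact: ess_sub_trans gf fh.
apply: TH_val_inj => /=.
by rewrite -(ess_equal_ext_max (sub_ess_equal_ext hf fh))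
           -(ess_equal_ext_max (sub_ess_equal_ext hg gh)).
Qed.

Lemma elt_surj a : exists f, a = elt f.
Proof. by case: a => m hm; have [f _ fm] := hm; exists f; exact: TH_val_inj. Qed.

Lemma mul_elt g f : Defs.mul (elt g) (elt f) = elt (Defs.comp g f).
Proof.
have [f1 f2] := ess_sub_max f; have [g1 g2] := ess_sub_max g.
by apply/eltP; split; exact: ess_sub_comp.
Qed.

Lemma TH_mulA a b c : Defs.mul a (Defs.mul b c) = Defs.mul (Defs.mul a b) c.
Proof.
have [f ->] := elt_surj a; have [g ->] := elt_surj b; have [h ->] := elt_surj c.
rewrite !mul_elt; congr elt; apply: riHom_ext => x /=.
by case: (h x).
Qed.

(** * The L-preorder and the idempotent order *)

Lemma leL_refl a : leL a a.
Proof.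
have [f ->] := elt_surj a; exists (elt id_hom); rewrite mul_elt; congr elt.
by apply: riHom_ext => x /=; case: (f x).
Qed.

Lemma leL_trans b a c : leL a b -> leL b c -> leL a c.
Proof. by move=> [u ->] [v ->]; exists (Defs.mul u v); rewrite TH_mulA. Qed.

Lemma Lclass_eq a b : leL a b -> leL b a -> Lclass a = Lclass b.
Proof.
move=> ab ba; apply/seteqP; split=> c [h1 h2]; split;
  by [apply: leL_trans h1 _|apply: leL_trans h2].
Qed.

Lemma le_idem_anti a b : le_idem a b -> le_idem b a -> a = b.
Proof. by move=> [_ _ ab _] [_ _ _ ba]; exact: etrans ab (esym ba). Qed.

(** The factor sends [f x] to [g x]. Since [g] is defined on all of [Dom f], the domain of the
    factor is the whole image of [f], generated by the images of the generators of [Dom f]. *)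
Lemma left_factor f g : Dom g = Dom f ->
  (forall x x', Dom f x -> f x = f x' -> g x = g x') ->
  exists h, Defs.comp h f = g.
Proof.
move=> gfD fg.
(* Off the image of [f] the default [None] is taken; on it, the constancy of [g] on the fibres of
   [f] leaves a single candidate. *)
pose hf y := xget None [set o | exists x, f x = Some y /\ o = g x].
have hfE x y : f x = Some y -> hf y = g x.
  move=> fx; apply: xget_unique; first by exists x.
  move=> _ [x' [fx' ->]]; apply: fg; first by apply/DomP; exists y.
  by rewrite fx.
have hfN y : ~ (exists x, f x = Some y) -> hf y = None.
  by move=> N; rewrite /hf; case: xgetP => // o _ [x [fx _]]; case: N; exists x.
have hh : ri_hom hf.
  move=> y z w; have [[x fx]|/hfN -> //] := pselect (exists x, f x = Some y).
  by rewrite (hfE _ _ fx) (hfE _ _ (ri_homP w fx)) => /ri_homP.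
have [P finP fP] := ri_fg f.
have hfg : exists2 Q : set (seq A), finite_set Q & Dom hf = gen Q.
  exists [set odflt [::] (f p) | p in P]; first exact: finite_image.
  have DP p : P p -> Dom f p.
    by move=> Pp; rewrite fP; exists p => //; exists [::] => //; rewrite cats0.
  apply/seteqP; split=> y.
    move=> /DomP[z]; have [[x fx]|/hfN -> //] := pselect (exists x, f x = Some y).
    move=> _; have : Dom f x by apply/DomP; exists y.
    rewrite fP => -[p Pp [w _ xE]]; have /DomP[q fp] := DP _ Pp.
    exists q; first by exists p; rewrite ?fp.
    by exists w => //; move: fx; rewrite -xE (ri_homP w fp) => -[].
  move=> [_ [p Pp <-] [w _ <-]]; have /DomP[q fp] := DP _ Pp.
  rewrite fp /=; apply: (Dom_right_ideal hh).
  have : Dom g p by rewrite gfD; apply/DomP; exists q.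
  by rewrite /Dom /= (hfE _ _ fp).
exists (RiHom hh hfg); apply: riHom_ext => x /=.
case fx: (f x) => [y|] /=; first exact: hfE.
case gx: (g x) => [z|] //.
have : Dom f x by rewrite -gfD; apply/DomP; exists z.
by move=> /DomP[y]; rewrite fx.
Qed.

End EssentialInclusion.

(** * The idempotents attached to [part] *)

Section FuncPart.
Context {disp : Order.disp_t} {A : finOrderType disp}.
Implicit Types (f g : riHom A) (x y : seq A) (j : bool).

Lemma funcP j f (hf : prefix_code_congruence (part f)) x y :
  func j hf x = Some y <-> Dom f x /\ is_extremum j (part f x) y.
Proof.
rewrite /= /func_fun; split.
  case: asboolP => // Rx [<-]; split; first exact: Rx.1.
  have [z hz] := extremum_exists j hf Rx.
  exact: (xgetI _ hz).
move=> [fx hy]; rewrite asboolT //; congr Some.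
by apply: xget_unique => // z hz; exact: extremum_unique hz hy.
Qed.

Lemma extremum_mem j (C : set (seq A)) y : is_extremum j C y -> C y.
Proof. by case: j => -[]. Qed.

Lemma func_fiber j f (hf : prefix_code_congruence (part f)) x y :
  func j hf x = Some y -> f y = f x.
Proof. by move=> /funcP[_ /extremum_mem [_ [_ ->]]]. Qed.

Lemma Dom_func j f (hf : prefix_code_congruence (part f)) :
  Dom (func j hf) = Dom f.
Proof.
apply/seteqP; split=> x; first by move=> /DomP[y /funcP[]].
move=> fx; have [y hy] := @extremum_exists _ _ j _ x hf (conj fx (conj fx erefl)).
by apply/DomP; exists y; apply/funcP.
Qed.

Lemma func_eq j f (hf : prefix_code_congruence (part f)) x x' :
  f x = f x' -> func j hf x = func j hf x'.
Proof.
move=> fxx'; have partE : part f x = part f x'.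
  by apply/funext => z; rewrite /part /Dom /= fxx'.
apply/eqP; case e: (func j hf x) => [y|]; apply/eqP/esym.
  move/funcP: e => [Dx hy]; apply/funcP; split; last by rewrite -partE.
  by move: Dx; rewrite /Dom /= fxx'.
case e': (func j hf x') => [y|] //.
move/funcP: e' => [Dx hy]; rewrite -e; apply/esym/funcP; split; last by rewrite partE.
by move: Dx; rewrite /Dom /= fxx'.
Qed.

(** An extremum shares the class, hence the extremum, of the word it comes from. *)
Lemma func_idem j f (hf : prefix_code_congruence (part f)) x y :
  func j hf x = Some y -> func j hf y = Some y.
Proof. by move=> e; rewrite -e; apply: func_eq; exact: func_fiber e. Qed.

Lemma idempotent_func j f (hf : prefix_code_congruence (part f)) :
  idempotent_elt (elt (func j hf)).
Proof.
rewrite /idempotent_elt mul_elt; congr elt; apply: riHom_ext => x.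
rewrite [LHS]/(obind _ _); case e: (func j hf x) => [y|] //=.
exact: func_idem e.
Qed.

Lemma comp_func j f (hf : prefix_code_congruence (part f)) :
  Defs.comp f (func j hf) = f.
Proof.
apply: riHom_ext => x; rewrite [LHS]/(obind _ _).
case e: (func j hf x) => [y|] /=; first exact: func_fiber e.
case fx: (f x) => [z|] //.
have : Dom (func j hf) x by rewrite Dom_func; apply/DomP; exists z.
by move=> /DomP[y]; rewrite e.
Qed.

Lemma leL_func j f (hf : prefix_code_congruence (part f)) :
  leL (elt f) (elt (func j hf)).
Proof. by exists (elt f); rewrite mul_elt comp_func. Qed.

Lemma func_leL j f (hf : prefix_code_congruence (part f)) :
  leL (elt (func j hf)) (elt f).
Proof.
have [|h hE] := @left_factor _ f (func j hf) (Dom_func j hf).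
  by move=> x x' _; exact: func_eq.
by exists (elt h); rewrite mul_elt hE.
Qed.

Lemma func_absorb j g f (hg : prefix_code_congruence (part g))
    (hf : prefix_code_congruence (part f)) (eg := func j hg)
    (ef := func j hf) :
  elt eg = Defs.mul (elt eg) (elt ef) -> elt eg = Defs.mul (elt ef) (elt eg).
Proof.
rewrite !mul_elt => /eltP[s1 s2].
have fix_eg x m : eg x = Some m -> exists w, ef (m ++ w) = Some (m ++ w).
  move=> egx; have egm : eg m = Some m by exact: func_idem egx.
  have [w] := s1 _ _ egm.
  move=> /comp_Some[t efm egt]; exists w.
  rewrite efm; congr Some.
  have /funcP[Dmw extf] := efm.
  have /funcP[Dt extg] := egt.
  (* [t] is the extremum of the [part f] class of [m ++ w], and [m ++ w] that of the [part g] class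
     of [t]. Each class contains the word it is taken at, so the two words bound each other. *)
  by case: (j) extf extg => -[_ ex1] [_ ex2];
    apply: dict_le_anti; do ?[exact: ex1|exact: ex2].
apply/eltP; split=> x y.
  move=> egx; have [w efw] := fix_eg _ _ egx.
  by exists w; apply/comp_Some; exists (y ++ w); first exact: ri_homP.
(* Here [ef] maps [m ++ w] both to itself and to [y ++ w], so [eg (x ++ w)] is [y ++ w]. *)
move=> /comp_Some[m egx efm].
have [w efw] := fix_eg _ _ egx; exists w.
by rewrite (ri_homP w egx) -efw (ri_homP w efm).
Qed.

Lemma leL_le_idem j g f (hg : prefix_code_congruence (part g))
    (hf : prefix_code_congruence (part f)) :
  leL (elt g) (elt f) <->
  le_idem (elt (func j hg)) (elt (func j hf)).
Proof.
split=> [gf|[_ _ ef _]]; last first.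
  apply: leL_trans (leL_func j hg) _; apply: leL_trans (func_leL j hf).
  by exists (elt (func j hg)).
have [c cE] : leL (elt (func j hg)) (elt (func j hf)).
  apply: leL_trans (func_leL j hg) _.
  exact: leL_trans gf (leL_func j hf).
(* A left multiple of an idempotent is fixed by right multiplication with it. *)
have ef : elt (func j hg) = Defs.mul (elt (func j hg)) (elt (func j hf)).
  by rewrite {2}cE -TH_mulA idempotent_func.
by split=> //; [exact: idempotent_func|exact: idempotent_func|exact: func_absorb].
Qed.

(** * Representatives whose [part] is a prefix code congruence *)

Lemma finite_words (n : nat) : finite_set [set x : seq A | size x = n].
Proof.
apply: (@sub_finite_set _ _ [set tval t | t in [set: n.-tuple A]]).
  by move=> x /eqP sx; exists (Tuple sx).
by apply: finite_image; exact: finite_finset.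
Qed.

Lemma gen_words (n : nat) :
  gen [set x : seq A | size x = n] = [set x | (n <= size x)%N].
Proof.
apply/seteqP; split=> [_ [p /= <- [w _ <-]]|x /= nx]; first by rewrite size_cat leq_addr.
exists (take n x); first by rewrite /= size_takel.
by exists (drop n x); rewrite ?cat_take_drop.
Qed.

Definition long (n : nat) : riHom A := id_on (finite_words n).

Lemma longE n x : long n x = if (n <= size x)%N then Some x else None.
Proof. by rewrite /= /id_on_fun gen_words /= asboolb. Qed.

(** Appending [n] copies of a letter makes any image long enough, so the restriction is
    essential. *)
Lemma ess_sub_long (a0 : A) n f :
  ess_sub f (Defs.comp (long n) f) /\ ess_sub (Defs.comp (long n) f) f.
Proof.
split=> x y.
  move=> fx; exists (nseq n a0).
  apply/comp_Some; exists (y ++ nseq n a0); first exact: ri_homP.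
  by rewrite longE size_cat size_nseq leq_addl.
move=> /comp_Some[z fx]; rewrite longE; case: ifP => // _ [<-].
by exists [::]; rewrite !cats0.
Qed.

(* If [n] bounds the images of the generators of [Dom f], then the generators
   of the domain of the restriction are the words with image of length [n]. *)
Lemma pcc_long f : exists n, prefix_code_congruence (part (Defs.comp (long n) f)).
Proof.
have [Q finQ fQ] := ri_fg f.
have /finite_seqP[s sQ] := finQ.
(* The words of [s] generate [Dom f], so on them the default is never taken. *)
pose im (p : seq A) := odflt [::] (f p).
pose n := \max_(p <- s) size (im p); exists n; set g := Defs.comp _ _.
have gE x y : g x = Some y <-> f x = Some y /\ (n <= size y)%N.
  split=> [/comp_Some[z fx]|[fx ny]].
    by rewrite longE; case: ifP => // nz [<-].
  by apply/comp_Some; exists y; rewrite ?longE ?ny.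
pose P := [set p | exists2 u, g p = Some u & size u = n].
have cut x y : g x = Some y -> exists p u w,
    [/\ x = p ++ w, y = u ++ w, g p = Some u & size u = n].
  move=> /gE[fx ny].
  have : Dom f x by apply/DomP; exists y.
  rewrite fQ => -[q Qq [w _ xE]].
  have : Dom f q by rewrite fQ; exists q => //; exists [::] => //; rewrite cats0.
  move=> /DomP[r fq].
  have rn : (size r <= n)%N.
    have qs : q \in s by move: Qq; rewrite sQ.
    have := @leq_bigmax_seq _ s xpredT (fun p => size (im p)) q qs isT.
    by rewrite /im fq.
  have yE : y = r ++ w by move: fx; rewrite -xE (ri_homP w fq) => -[].
  (* The first [m] letters of [w], appended to [q], bring the length of the image to exactly [n]. *)
  pose m := (n - size r)%N.
  have mw : (m <= size w)%N by rewrite leq_subLR -size_cat -yE.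
  have sz : size (r ++ take m w) = n by rewrite size_cat size_takel // subnKC.
  exists (q ++ take m w), (r ++ take m w), (drop m w).
  rewrite -!catA !cat_take_drop; split=> //.
  by apply/gE; rewrite sz (ri_homP _ fq).
(* A proper extension of a word of [P] has an image longer than [n]. *)
have Pc : prefix_code P.
  move=> p q [u gp su] [v gq sv] /prefixP[t tE].
  move: gq; rewrite tE (ri_homP t gp) => -[vE].
  move: sv; rewrite -vE size_cat su => /eqP; rewrite -{2}(addn0 n) eqn_add2l.
  by move=> /nilP ->; rewrite cats0.
have gP : Dom g = gen P.
  apply/seteqP; split=> [x /DomP[y /cut[p [u [w [-> _ gp su]]]]]|].
    by exists p; [exists u|exists w].
  move=> _ [p [u gp su] [w _ <-]]; apply/DomP; exists (u ++ w).
  exact: ri_homP.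
(* [P] lies in any generating set [R] of [Dom g]: a prefix [r] of [p] in [R] already has an image of
   length at least [n], so [r = p]. *)
have finP : finite_set P.
  have [R finR gR] := ri_fg g.
  apply: sub_finite_set finR => p [u gp su].
  have : Dom g p by apply/DomP; exists u.
  rewrite gR => -[r Rr [w _ rw]].
  have : Dom g r by rewrite gR; exists r => //; exists [::] => //; rewrite cats0.
  move=> /DomP[v gr]; have /gE[_ nv] := gr.
  move: gp; rewrite -rw (ri_homP w gr) => -[uE].
  move: su; rewrite -uE size_cat => e.
  suff /nilP -> : size w == 0%N by rewrite cats0.
  by rewrite -leqn0 -(leq_add2l (size v)) addn0 e.
have /finite_seqP[t tE] : finite_set [set u | exists2 p, P p & g p = Some u].
  apply: sub_finite_set (finite_words n) => u [p [v gp sv]].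
  by rewrite gp => -[<-].
(* The parts of [P] are indexed by the distinct images of its words; without [undup] a part could
   occur under two indices. *)
pose t' := undup t.
have tP i : (i < size t')%N -> exists2 p, P p & g p = Some (nth [::] t' i).
  move=> it; have : [set` t] (nth [::] t' i) by rewrite /= -mem_undup mem_nth.
  by rewrite -tE.
exists P, (size t'), (fun i => [set p | P p /\ g p = Some (nth [::] t' i)]).
split=> //.
- rewrite -gP; split.
  + by move=> x y [gx [gy _]].
  + by move=> x gx.
  + by move=> x y [gx [gy e]].
  + by move=> x y z [gx [gy e]] [_ [gz e']]; split=> //; split=> //; rewrite e.
- split.
  + apply/seteqP; split=> [p [i _ [] //]|p Pp].
    have [u gp su] := Pp.
    have ut : u \in t'.
      by rewrite mem_undup; have : [set` t] u by rewrite -tE; exists p.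
    have it : (index u t' < size t')%N by rewrite index_mem.
    by exists (Ordinal it) => //=; rewrite nth_index.
  + move=> i i' _ _ [p [[_ e] [_]]]; rewrite e => -[/eqP].
    by rewrite nth_uniq ?undup_uniq // => /eqP/val_inj.
  + by move=> i _; have [p Pp gp] := tP i (ltn_ord i); exists p.
have cls i p w : P p -> g p = Some (nth [::] t' i) ->
    part g (p ++ w) = rmul [set p | P p /\ g p = Some (nth [::] t' i)] w.
  move=> Pp gp; apply/seteqP; split=> [x [_ [/DomP[y gx]]]|_ [q [Pq gq] <-]].
    rewrite gx (ri_homP w gp) => -[yE].
    (* Both factorisations of the image of [x] are cut at length [n], so their halves agree. *)
    have [q [u [v [xE yE' gq su]]]] := cut _ _ gx.
    have [u' gp' su'] := Pp; move: gp'; rewrite gp => -[u'E].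
    move: yE'; rewrite -yE u'E => /eqP.
    rewrite eqseq_cat ?su ?su' // => /andP[/eqP uE /eqP wE].
    exists q; last by rewrite xE wE.
    by split; [exists u|rewrite gq uE].
  split; first by apply/DomP; exists (nth [::] t' i ++ w); exact: ri_homP.
  split; first by apply/DomP; exists (nth [::] t' i ++ w); exact: ri_homP.
  by rewrite (ri_homP w gp) (ri_homP w gq).
apply/seteqP; split=> [_ [_ [p Pp [w _ <-]] <-]|_ [i _ [w _ <-]]].
  have [u gp su] := Pp.
  have ut : u \in t'.
    by rewrite mem_undup; have : [set` t] u by rewrite -tE; exists p.
  have it : (index u t' < size t')%N by rewrite index_mem.
  exists (Ordinal it) => //; exists w => //.
  by apply/esym/cls => //=; rewrite nth_index.
have [p Pp gp] := tP i (ltn_ord i).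
by exists (p ++ w); [exists p => //; exists w|exact: cls].
Qed.

Lemma pcc_representative (a0 : A) (a : THmonoid A) :
  exists f, prefix_code_congruence (part f) /\ a = elt f.
Proof.
have [f ->] := elt_surj a; have [n hn] := pcc_long f.
by exists (Defs.comp (long n) f); split=> //; apply/eltP; exact: ess_sub_long.
Qed.

(** * The map on L-classes *)

(** Any two representatives from one L-class lie below each other in the L-preorder, so by
    [leL_le_idem] and antisymmetry their idempotents coincide. *)
Lemma func_partE j (C : set (THmonoid A)) f (hf : prefix_code_congruence (part f)) :
  range Lclass C -> C (elt f) -> func_part j C = elt (func j hf).
Proof.
move=> [a _ <-] [fa af]; apply: xget_unique; first by exists f, hf.
move=> _ [g [hg [[ga ag] ->]]].
by apply: le_idem_anti; apply/leL_le_idem; exact: leL_trans af || exact: leL_trans ag.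
Qed.

End FuncPart.

Theorem proposition4p3 (k : nat) (disp : Order.disp_t) (A : finOrderType disp)
    (hk : (2 <= k)%N) (hA : #|A| = k) (j : bool) :
  [/\ forall (C : set (THmonoid A)) (phi : riHom A)
        (hphi : prefix_code_congruence (part phi)),
        range Lclass C -> C (elt phi) ->
        func_part j C = elt (func j hphi),
      set_inj (range Lclass) (func_part j : set (THmonoid A) -> THmonoid A),
      forall (psi phi : riHom A)
        (hpsi : prefix_code_congruence (part psi))
        (hphi : prefix_code_congruence (part phi)),
        leL (elt psi) (elt phi) <->
        le_idem (elt (func j hpsi)) (elt (func j hphi)) &
      forall psi phi : riHom A,
        leL (elt psi) (elt phi) <->
        le_idem (func_part j (Lclass (elt psi))) (func_part j (Lclass (elt phi)))].
Proof.
have [a0 _] : exists a0 : A, a0 \in A by apply/card_gt0P; rewrite hA; exact: ltnW hk.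
have repr (a : THmonoid A) : exists2 f, a = elt f &
    exists hf : prefix_code_congruence (part f),
      func_part j (Lclass a) = elt (func j hf).
  have [f [hf aE]] := pcc_representative a0 a; exists f => //; exists hf.
  by apply: func_partE; [exists a|rewrite -aE; split; exact: leL_refl].
split=> [C phi hphi||psi phi hpsi hphi|psi phi].
- exact: func_partE.
- move=> _ _ /set_mem [a _ <-] /set_mem [b _ <-].
  have [[f aE [hf ->]] [g bE [hg ->]]] := (repr a, repr b).
  move=> e; rewrite aE bE.
  (* Equal idempotents lie below each other, and [leL_le_idem] turns this into L-equivalence of [f]
     and [g]. *)
  have hid := idempotent_func j hg.
  have rid : le_idem (elt (func j hg)) (elt (func j hg)).
    by split=> //; exact/esym.
  by apply: Lclass_eq; [apply/(leL_le_idem j hf hg)|apply/(leL_le_idem j hg hf)];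
    rewrite e.
- exact: leL_le_idem.
- have [[f -> [hf ->]] [g -> [hg ->]]] := (repr (elt psi), repr (elt phi)).
  exact: leL_le_idem.
Qed.
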